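(* Let $A$ be a $C^*$-algebra, $H$ a Hilbert $A$-module, and let $P,Q\in\mathcal{L}(H)$ be two projections such that $\overline{\mathcal{R}(2I-P-Q)}$ is orthogonally complemented in $H$. Then $\mathcal{R}(P)\cap\mathcal{R}(Q)$ is also orthogonally complemented in $H$, and $\overline{\mathcal{R}(QP)}$ has the orthogonal decomposition $$\overline{\mathcal{R}(QP)}=\overline{\mathcal{R}\big(QP(I-Q)\big)}\dotplus\mathcal{R}(P)\cap\mathcal{R}(Q),$$ that is, the two summands on the right are orthogonal to each other and their sum is $\overline{\mathcal{R}(QP)}$.
   Context: $\mathcal{L}(H)$ is the $C^*$-algebra of adjointable operators on the Hilbert $A$-module $H$; a projection is $P\in\mathcal{L}(H)$ with $P=P^2=P^*$; $\mathcal{R}$ denotes range. A closed submodule $M\subseteq H$ is orthogonally complemented in $H$ if $H=M+M^\perp$, where $M^\perp=\{x\in H:\langle x,y\rangle=0\ \forall y\in M\}$. For submodules $H_1,H_2$ of $H$ with $H_1\cap H_2=\{0\}$, $H_1\dotplus H_2=\{h_1+h_2:h_i\in H_i\}$. *)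

(* Defs.v *)
From HB Require Import structures.
From mathcomp Require Import all_boot all_order all_algebra.
From mathcomp Require Import all_classical all_reals all_analysis.
From mathcomp Require Import complex.

Set Implicit Arguments.
Unset Strict Implicit.
Unset Printing Implicit Defensive.

Import Order.TTheory GRing.Theory Num.Theory.
Import numFieldNormedType.Exports.

Local Open Scope classical_set_scope.
Local Open Scope ring_scope.
Local Open Scope complex_scope.

(* C*-algebras are not assumed to be unital, so the product is a separate
   operation: the ring structures of MathComp all carry a unit. *)
HB.mixin Record isCStarAlgebra (R : realType) A
    of CompleteNormedModule R[i] A := {
  cmul : A -> A -> A;
  cstar : A -> A;
  cmulA : forall a b c, cmul a (cmul b c) = cmul (cmul a b) c;
  cmulDl : forall a b c, cmul (a + b) c = cmul a c + cmul b c;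
  cmulDr : forall a b c, cmul a (b + c) = cmul a b + cmul a c;
  cmulZl : forall (k : R[i]) a b, cmul (k *: a) b = k *: cmul a b;
  cmulZr : forall (k : R[i]) a b, cmul a (k *: b) = k *: cmul a b;
  cstarK : forall a, cstar (cstar a) = a;
  cstarD : forall a b, cstar (a + b) = cstar a + cstar b;
  cstarZ : forall (k : R[i]) a, cstar (k *: a) = k^* *: cstar a;
  cstarM : forall a b, cstar (cmul a b) = cmul (cstar b) (cstar a);
  cmul_norm : forall a b, `|cmul a b| <= `|a| * `|b|;
  cstar_norm : forall a, `|cmul (cstar a) a| = `|a| ^+ 2
}.

#[short(type="cstarAlgType")]
HB.structure Definition CStarAlgebra (R : realType) :=
  { A of isCStarAlgebra R A & CompleteNormedModule R[i] A }.

Definition cpos (R : realType) (A : cstarAlgType R) (a : A) : Prop :=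
  exists b : A, a = cmul (cstar b) b.

(* A Hilbert A-module is a right module with an A-valued inner product that is
   linear in its second variable. [hip_norm] says that the norm carried by H is
   x |-> |<x, x>|^(1/2), so that H is complete for that norm. *)
HB.mixin Record isHilbertModule (R : realType) (A : cstarAlgType R) H
    of CompleteNormedModule R[i] H := {
  hact : H -> A -> H;
  hip : H -> H -> A;
  hactDl : forall x y a, hact (x + y) a = hact x a + hact y a;
  hactDr : forall x a b, hact x (a + b) = hact x a + hact x b;
  hactM : forall x a b, hact x (cmul a b) = hact (hact x a) b;
  hactZl : forall (k : R[i]) x a, hact (k *: x) a = k *: hact x a;
  hactZr : forall (k : R[i]) x a, hact x (k *: a) = k *: hact x a;
  hipDr : forall x y z, hip x (y + z) = hip x y + hip x z;
  hipZr : forall (k : R[i]) x y, hip x (k *: y) = k *: hip x y;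
  hip_act : forall x y a, hip x (hact y a) = cmul (hip x y) a;
  hip_star : forall x y, hip y x = cstar (hip x y);
  hip_ge0 : forall x, cpos (hip x x);
  hip_eq0 : forall x, hip x x = 0 -> x = 0;
  hip_norm : forall x, `|x| ^+ 2 = `|hip x x|
}.

#[short(type="hilbertModType")]
HB.structure Definition HilbertModule (R : realType) (A : cstarAlgType R) :=
  { H of isHilbertModule R A H & CompleteNormedModule R[i] H }.

Section HilbertModuleDefs.
Context {R : realType} {A : cstarAlgType R} {H : hilbertModType A}.
Implicit Types (S T P : H -> H) (M N : set H).

Definition is_adjoint T S : Prop :=
  forall x y, hip (T x) y = hip x (S y) :> A.

(* Membership in L(H): (A-)linearity and boundedness of T are consequences of
   the existence of an adjoint. *)
Definition adjointable T : Prop := exists S, is_adjoint T S.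

Definition is_projection P : Prop :=
  [/\ adjointable P, P \o P = P & is_adjoint P P].

Definition submodule M : Prop :=
  [/\ M 0,
      forall x y, M x -> M y -> M (x + y),
      forall (k : R[i]) x, M x -> M (k *: x)
    & forall x (a : A), M x -> M (hact x a)].

Definition orthogonal M N : Prop :=
  forall x y, M x -> N y -> hip x y = 0 :> A.

Definition orthogonal_complement M : set H :=
  [set x | forall y, M y -> hip x y = 0 :> A].

Definition sumset M N : set H :=
  [set x | exists m n, [/\ M m, N n & x = m + n]].

Definition orthogonally_complemented M : Prop :=
  [/\ closed M, submodule M & sumset M (orthogonal_complement M) = setT].

(* M = M1 \dotplus M2, with M1 and M2 orthogonal to each other. *)
Definition orthogonal_decomposition M M1 M2 : Prop :=
  [/\ M1 `&` M2 = [set 0], orthogonal M1 M2 & M = sumset M1 M2].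

End HilbertModuleDefs.

(* Main.v *)
(* The self-adjoint operator D = 2 - P - Q has kernel N := R(P) /\ R(Q), so N is
   the orthogonal complement of closure R(D) and H = closure R(D) + N. Since
   QPD = QP(I - Q), QP maps closure R(D) into L := closure R(QP(I - Q)), and it
   fixes N pointwise; hence R(QP) is contained in L + N. If E is the projection
   onto N, then I - E maps R(QP) into L, hence also its closure, because I - E is
   continuous and L is closed. *)
From HB Require Import structures.
Require Import Defs.
From mathcomp Require Import all_boot all_order all_algebra.
From mathcomp Require Import all_classical all_reals all_analysis.
From mathcomp Require Import complex.
Import Order.TTheory GRing.Theory Num.Theory.
Import numFieldNormedType.Exports.
Local Open Scope classical_set_scope.
Local Open Scope ring_scope.

(** The algebra behind polarization, with [b] and [c] standing for [hip x y] and [hip y x]: the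
    factor [- i * i = 1] makes the [c] terms cancel. *)
Lemma scaler_polarization (K : comPzRingType) (V : lmodType K) (i : K) (b c : V) :
  i ^+ 2 = -1 -> 4 *: b = 2 *: (b + c) - i *: (2 *: (i *: (b - c))).
Proof.
move=> i2; rewrite (scalerA i) mulrC -scalerA -scalerBr scalerA -expr2 i2.
by rewrite scaleN1r opprK addrACA subrr addr0 -mulr2n -scaler_nat scalerA -natrM.
Qed.

(** * Calculus and boundedness of the inner product *)

Section HilbertModuleTheory.
Context {R : realType} {A : cstarAlgType R} {H : hilbertModType A}.
Implicit Types (x y z : H) (k : R[i]) (M N : set H) (P T S : H -> H).

Lemma cstar0 : cstar 0 = 0 :> A.
Proof. by rewrite -[in LHS](scale0r (0 : A)) cstarZ conjC0 scale0r. Qed.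

Lemma hipDl x y z : hip (x + y) z = hip x z + hip y z :> A.
Proof. by rewrite hip_star hipDr cstarD -!hip_star. Qed.

Lemma hipZl k x y : hip (k *: x) y = k^* *: hip x y :> A.
Proof. by rewrite hip_star hipZr cstarZ -hip_star. Qed.

Lemma hip0r x : hip x 0 = 0 :> A.
Proof. by rewrite -[in LHS](scale0r (0 : H)) hipZr scale0r. Qed.

Lemma hip0l x : hip 0 x = 0 :> A.
Proof. by rewrite hip_star hip0r cstar0. Qed.

Lemma hipNr x y : hip x (- y) = - hip x y :> A.
Proof. by rewrite -[in LHS]scaleN1r hipZr scaleN1r. Qed.

Lemma hipNl x y : hip (- x) y = - hip x y :> A.
Proof. by rewrite -[in LHS]scaleN1r hipZl rmorphN1 scaleN1r. Qed.

Lemma hipBr x y z : hip x (y - z) = hip x y - hip x z :> A.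
Proof. by rewrite hipDr hipNr. Qed.

Lemma hipBl x y z : hip (x - y) z = hip x z - hip y z :> A.
Proof. by rewrite hipDl hipNl. Qed.

Lemma hip_eq0C x y : hip x y = 0 :> A -> hip y x = 0 :> A.
Proof. by rewrite (hip_star x y) => ->; rewrite cstar0. Qed.

Lemma hip_addsub x y :
  hip (x + y) (x + y) - hip (x - y) (x - y) = 2 *: (hip x y + hip y x) :> A.
Proof.
rewrite !(hipDr, hipDl, hipNr, hipNl) scaler_nat mulr2n !opprD !opprK !addrA.
by rewrite [LHS](ACl ((1 * 5) * (4 * 8) * 2 * 3 * 6 * 7))/= !subrr !add0r.
Qed.

(* Only [i ^+ 2 = -1] and [i^* = - i] matter; with the term ['i] itself the
   scaling would be inferred over a different instance of [R[i]]. *)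
Lemma hip_polarization (i : R[i]) x y : i ^+ 2 = -1 -> i^* = - i ->
  4 *: hip x y = hip (x + y) (x + y) - hip (x - y) (x - y)
    - i *: (hip (x + i *: y) (x + i *: y) - hip (x - i *: y) (x - i *: y)) :> A.
Proof.
move=> i2 iC; rewrite !hip_addsub hipZr hipZl iC scaleNr -scalerBr.
exact: scaler_polarization.
Qed.

(** Each of the four squares in the polarization identity is some [hip (x + z) (x + z)] with [z] of
    the same norm as [y], so the triangle inequality bounds it by the right-hand side. *)
Lemma hip_norm_le x y : `|hip x y : A| <= (`|x| + `|y|) ^+ 2.
Proof.
have le z : `|z| = `|y| -> `|hip (x + z) (x + z) : A| <= (`|x| + `|y|) ^+ 2.
  by move=> <-; rewrite -hip_norm ler_sqr ?nnegrE ?addr_ge0 ?ler_normD.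
pose i : R[i] := 'i; have ni : `|i| = 1 by exact: normCi.
have iy : `|i *: y| = `|y| by rewrite normrZ ni mul1r.
rewrite -(ler_pM2l (ltr0n R[i] 4)) -{1}normr_nat -normrZ.
rewrite (hip_polarization i) ?sqrCi ?conjCi//.
rewrite (le_trans (ler_normB _ _))// normrZ ni mul1r.
rewrite (le_trans (lerD (ler_normB _ _) (ler_normB _ _)))//.
rewrite [leRHS]mulr_natl -[4%N]/(2 + 2)%N mulrnDr !mulr2n.
by rewrite !lerD ?le ?normrN.
Qed.

(* The polarization identity replaces the Cauchy-Schwarz inequality, whose
   proof needs the order on A, at the cost of the constant 4. *)
Lemma hip_bounded x y : `|hip x y : A| <= 4 * `|x| * `|y|.
Proof.
have [->|x0] := eqVneq x 0; first by rewrite hip0l !normr0 mulr0 mul0r.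
have [->|y0] := eqVneq y 0; first by rewrite hip0r !normr0 mulr0.
have nx : `|x| * `|x|^-1 = 1 by rewrite divff ?normr_eq0.
have ny : `|y| * `|y|^-1 = 1 by rewrite divff ?normr_eq0.
(* For vectors of norm 1 the previous bound is [(1 + 1) ^+ 2 = 4]; homogeneity does the rest. *)
have := hip_norm_le (`|x|^-1 *: x) (`|y|^-1 *: y).
rewrite hipZl hipZr !normrZ norm_conjC !normfV !normr_id.
rewrite ![_^-1 * `|_|]mulrC nx ny -[1 + 1]/2 -natrX.
rewrite [leLHS]mulrC -[leLHS]mulrA -invfM ler_pdivrMr ?mulr_gt0 ?normr_gt0//.
by rewrite [`|y| * _]mulrC mulrA.
Qed.

(** * Continuity of the maps involved *)

Lemma bounded_linear_map_continuous {V W : normedModType R[i]} (f : V -> W) c :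
  c \is Num.real -> linear f -> (forall u, `|f u| <= c * `|u|) -> continuous f.
Proof.
move=> cR flin fc.
pose g : {linear V -> W} := HB.pack f (GRing.isLinear.Build _ _ _ _ f flin).
(* The order on [R[i]] is partial: [c <= r] holds for all large [r] because [c] is real. *)
apply/(linear_bounded_continuous g)/linear_boundedP; near=> r => u.
rewrite (le_trans (fc u))// ler_wpM2r//.
Unshelve. all: end_near. Qed.

Lemma hip_continuous x : continuous (hip x : H -> A).
Proof.
apply: (@bounded_linear_map_continuous _ _ _ (4 * `|x|)) => [|k u v|u].
- by rewrite realM ?realn ?normr_real.
- by rewrite hipDr hipZr.
- exact: hip_bounded.
Qed.

Lemma hip_inj x y : (forall z, hip x z = hip y z :> A) -> x = y.
Proof.
move=> xy; apply/eqP; rewrite -subr_eq0; apply/eqP/(@hip_eq0 _ A).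
by rewrite hipBl xy subrr.
Qed.

Lemma adjoint_linear T S : is_adjoint T S -> linear T.
Proof.
by move=> TS k x y; apply: hip_inj => z; rewrite TS !hipDl !hipZl !TS.
Qed.

Lemma adjointD T S : is_adjoint T S -> forall x y, T (x + y) = T x + T y.
Proof. by move=> TS x y; apply: hip_inj => z; rewrite TS !hipDl !TS. Qed.

Lemma adjointB T S : is_adjoint T S -> forall x y, T (x - y) = T x - T y.
Proof. by move=> TS x y; apply: hip_inj => z; rewrite TS !hipBl !TS. Qed.

(** From [hip (P u) (P u) = hip (P u) u] one gets [|P u|^2 <= 4 |u| |P u|], and one factor [|P u|]
    cancels. *)
Lemma selfadjoint_idem_continuous P :
  is_adjoint P P -> P \o P = P -> continuous P.
Proof.
move=> PP PK; have PE x : P (P x) = P x by rewrite -[LHS]/((P \o P) x) PK.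
apply: (@bounded_linear_map_continuous _ _ _ 4) => [||u].
- exact: realn.
- exact: adjoint_linear PP.
- have [->|Pu0] := eqVneq (P u) 0; first by rewrite normr0 mulr_ge0.
  rewrite -(ler_pM2r (_ : 0 < `|P u|)) ?normr_gt0// -expr2 (@hip_norm _ A).
  by rewrite -PP PE (le_trans (hip_bounded _ _))// mulrAC.
Qed.


(** * Orthogonal complements and their projections *)

Lemma orthogonal_complement_closed M : closed (orthogonal_complement (A := A) M).
Proof.
(* The arguments are swapped because [hip_continuous] concerns the second variable. *)
have -> : orthogonal_complement (A := A) M =
    \bigcap_(y in M) (hip y : H -> A) @^-1` [set 0].
  by apply/seteqP; split=> x /= Mx y My; apply: hip_eq0C; exact: Mx.
apply: closed_bigI => y _; apply: preimage_closed.
  by move=> x _; exact: hip_continuous.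
exact: accessible_closed_set1 (hausdorff_accessible (@norm_hausdorff _ _)) _.
Qed.

Lemma orthogonal_complement_submodule M :
  submodule (orthogonal_complement (A := A) M).
Proof.
split=> [y _|x y Mx My z Mz|k x Mx z Mz|x a Mx z Mz].
- exact: hip0l.
- by rewrite hipDl Mx// My// addr0.
- by rewrite hipZl Mx// scaler0.
- apply: hip_eq0C; rewrite hip_act (hip_eq0C _ _ (Mx z Mz)).
  by rewrite -[0 in LHS](scale0r (0 : A)) cmulZl scale0r.
Qed.

Lemma orthogonal_complement_eq0 M x :
  M x -> orthogonal_complement M x -> x = 0.
Proof. by move=> Mx; move/(_ _ Mx)/(@hip_eq0 _ A). Qed.

(** The preimage of [D] is closed and contains [B]. This reduces claims about the closure of a range
    to the range itself. *)
Lemma preimage_closure_subset {U V : topologicalType}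
    (f : U -> V) (B : set U) (D : set V) :
  continuous f -> closed D -> (forall u, B u -> D (f u)) ->
  forall u, closure B u -> D (f u).
Proof.
move=> fc Dc BD; suff : closure B `<=` f @^-1` D by [].
rewrite ((closure_id _).1 (_ : closed (f @^-1` D))); last first.
  by apply: preimage_closed => // u _; exact: fc.
exact: closureS.
Qed.

Lemma orthogonal_closurel M y :
  (forall x, M x -> hip y x = 0 :> A) -> forall x, closure M x -> hip y x = 0 :> A.
Proof.
move=> My x.
apply: (@preimage_closure_subset _ _ (hip y : H -> A) M [set 0]) => //.
  exact: hip_continuous.
exact: accessible_closed_set1 (hausdorff_accessible (@norm_hausdorff _ _)) _.
Qed.

(** [E] picks a component in [N] by choice. Linearity and continuity are not checked by hand: they
    follow once [E] is self-adjoint and idempotent. *)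
Lemma complement_projection N : orthogonally_complemented N ->
  exists E : H -> H, [/\ is_adjoint E E, continuous E,
    forall x, N (E x), forall x, N x -> E x = x
    & forall x, orthogonal_complement N x -> E x = 0].
Proof.
move=> [_ [N0 ND NZ _] Nsum].
have [NC0 NCD NCZ _] := orthogonal_complement_submodule N.
have NN x : N x -> N (- x) by rewrite -scaleN1r; exact: NZ.
have NCN x : orthogonal_complement (A := A) N x ->
    orthogonal_complement (A := A) N (- x).
  by rewrite -scaleN1r; exact: NCZ.
have /choice[E NE] x : exists e, N e /\ orthogonal_complement (A := A) N (x - e).
  have : sumset N (orthogonal_complement (A := A) N) x by rewrite Nsum.
  by move=> [e [d [Ne Nd ->]]]; exists e; rewrite addrAC subrr add0r.
have uniq x e : N e -> orthogonal_complement (A := A) N (x - e) -> E x = e.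
  move=> Ne Nxe; have [NEx NxE] := NE x; apply/eqP; rewrite -subr_eq0; apply/eqP.
  apply: (orthogonal_complement_eq0 N); first by apply: ND => //; exact: NN.
  (* Two candidates for the component differ by an element of both [N] and its complement. *)
  have -> : E x - e = - (x - E x) + (x - e) by rewrite opprB addrA subrK.
  by apply: NCD => //; exact: NCN.
have EE : is_adjoint (A := A) E E.
  move=> x y; have [NEx NxE] := NE x; have [NEy NyE] := NE y.
  (* Both sides reduce to [hip (E x) (E y)]. *)
  rewrite -[y in LHS](subrK (E y)) hipDr (hip_eq0C _ _ (NyE _ NEx)) add0r.
  by rewrite -[x in RHS](subrK (E x)) hipDl (NxE _ NEy) add0r.
have EN x : N x -> E x = x by move=> Nx; apply: uniq; rewrite ?subrr.
exists E; split=> // [|x|x Nx]; last by apply: uniq; rewrite ?subr0.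
  apply: selfadjoint_idem_continuous => //.
  by apply/funext => x /=; apply/EN/(NE x).1.
exact: (NE x).1.
Qed.

End HilbertModuleTheory.

(** * The intersection of the ranges of two projections *)

Section TwoProjections.
Context {R : realType} {A : cstarAlgType R} {H : hilbertModType A}.
Context (P Q : H -> H) (hP : is_projection P) (hQ : is_projection Q).

Let PP : is_adjoint P P. Proof. by case: hP. Qed.
Let QQ : is_adjoint Q Q. Proof. by case: hQ. Qed.
Let PK x : P (P x) = P x.
Proof. by case: hP => _ PK _; rewrite -[LHS]/((P \o P) x) PK. Qed.
Let QK x : Q (Q x) = Q x.
Proof. by case: hQ => _ QK _; rewrite -[LHS]/((Q \o Q) x) QK. Qed.

(* With u = P x and v = Q x one gets u = P v and v = Q u, hence
   <u, v> = <u, u> and <v, u> = <v, v>, so that <u - v, u - v> = 0. *)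
Lemma meet_of_midpoint (x : H) : 2 *: x = P x + Q x -> P x = x /\ Q x = x.
Proof.
rewrite scaler_nat mulr2n => x2.
have Px : P x = P (Q x).
  by apply: (addrI (P x)); rewrite -(adjointD _ _ PP) x2 (adjointD _ _ PP) PK.
have Qx : Q x = Q (P x).
  by apply: (addIr (Q x)); rewrite -(adjointD _ _ QQ) x2 (adjointD _ _ QQ) QK.
have uv : hip (P x) (Q x) = hip (P x) (P x) :> A by rewrite -{1}PK PP -Px.
have vu : hip (Q x) (P x) = hip (Q x) (Q x) :> A by rewrite -{1}QK QQ -Qx.
have PQ : P x = Q x.
  apply/eqP; rewrite -subr_eq0; apply/eqP/(@hip_eq0 _ A).
  by rewrite hipBl !hipBr uv subrr vu subrr subr0.
have : (2 : R[i]) *: P x = 2 *: x by rewrite !scaler_nat !mulr2n x2 PQ.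
by move/(scalerI (lt0r_neq0 (ltr0n _ 2))) => E; rewrite -PQ.
Qed.

Lemma meet_orthogonal_complement :
  range P `&` range Q =
    orthogonal_complement (closure (range (fun x : H => 2 *: x - P x - Q x))).
Proof.
pose D (x : H) : H := 2 *: x - P x - Q x.
have DD : is_adjoint D D.
  by move=> x y; rewrite /D !hipBl !hipBr hipZl hipZr conjC_nat PP QQ.
apply/seteqP; split=> [x [[y _ yx] [z _ zx]] w|x xD].
  apply: orthogonal_closurel => _ [{}w _ <-].
  rewrite -[LHS]/(hip x (D w)) -DD /D.
  have -> : P x = x by rewrite -yx PK.
  have -> : Q x = x by rewrite -zx QK.
  by rewrite scaler_nat mulr2n addrK subrr hip0l.
(* Testing [x] against [D (D x)] gives [hip (D x) (D x) = 0], by self-adjointness. *)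
have : D x = 0.
  apply: (@hip_eq0 _ A); rewrite DD; apply: xD; apply: subset_closure.
  by exists (D x).
rewrite /D -addrA -opprD => /eqP; rewrite subr_eq0 => /eqP/meet_of_midpoint[Px Qx].
by split; exists x.
Qed.

End TwoProjections.

Theorem lemma4p2 (R : realType) (A : cstarAlgType R) (H : hilbertModType A)
    (P Q : H -> H) (hP : is_projection P) (hQ : is_projection Q)
    (hPQ : orthogonally_complemented
             (closure (range (fun x : H => 2 *: x - P x - Q x)))) :
  orthogonally_complemented (range P `&` range Q) /\
  orthogonal_decomposition
    (closure (range (Q \o P)))
    (closure (range (fun x : H => Q (P (x - Q x)))))
    (range P `&` range Q).
Proof.
have [[_ PK PP] [_ QK QQ]] := (hP, hQ).
have Pc := selfadjoint_idem_continuous _ PP PK.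
have Qc := selfadjoint_idem_continuous _ QQ QK.
have {}PK x : P (P x) = P x by rewrite -[LHS]/((P \o P) x) PK.
have {}QK x : Q (Q x) = Q x by rewrite -[LHS]/((Q \o Q) x) QK.
have NE := meet_orthogonal_complement _ _ hP hQ.
set N := range P `&` range Q in NE *.
have NPQ x : N x -> P x = x /\ Q x = x.
  by move=> [[y _ <-] [z _ zx]]; rewrite PK -zx QK.
set K := closure (range (fun x : H => 2 *: x - P x - Q x)) in NE hPQ *.
have QPc : continuous (Q \o P).
  by move=> x; apply: continuous_comp; [exact: Pc|exact: Qc].
have hN : orthogonally_complemented N.
  split.
  - by rewrite NE; exact: orthogonal_complement_closed.
  - by rewrite NE; exact: orthogonal_complement_submodule.
  (* As [N] is the complement of [K], also [K] is orthogonal to [N]: the splitting along [K], with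
     its terms exchanged, is one along [N]. *)
  - have [_ _ Ksum] := hPQ; apply/seteqP; split=> // x _.
    have : sumset K (orthogonal_complement K) x by rewrite Ksum.
    move=> [m [n [Km Nn ->]]]; exists n, m; split; [by rewrite NE| |exact: addrC].
    by rewrite NE => y Ny; apply: hip_eq0C; exact: Ny.
split=> //.
set L := closure (range (fun x : H => Q (P (x - Q x)))).
have NL y : N y -> forall x, L x -> hip y x = 0 :> A.
  move=> Ny; apply: orthogonal_closurel => _ [x _ <-].
  have [Py Qy] := NPQ y Ny.
  (* Moving [Q] and [P] onto [y], which they fix, leaves [hip y (x - Q x)]; moving the last [Q]
     across makes it vanish. *)
  by rewrite -QQ Qy -PP Py hipBr -QQ Qy subrr.
have Lcl : closed L by exact: closed_closure.
split.
- apply/seteqP; split=> [x [Lx Nx]|_ ->].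
    by apply: (@hip_eq0 _ A); exact: NL.
  have [_ [N0 _ _ _] _] := hN; split=> //; apply: subset_closure; exists 0 => //.
  have P0 : P 0 = 0 by case: (NPQ 0 N0).
  have Q0 : Q 0 = 0 by case: (NPQ 0 N0).
  by rewrite Q0 subr0 P0 Q0.
- by move=> x y Lx Ny; apply: hip_eq0C; exact: NL.
have [E [EE Ec EN EidN E0]] := complement_projection _ hN.
apply/seteqP; split=> [z QPz|_ [m [n [Lm Nn ->]]]].
- exists (z - E z), (E z); split; [|exact: EN|by rewrite subrK].
  move: z QPz; apply: (preimage_closure_subset (fun z => z - E z)) => //.
    by move=> z; apply: cvgB; [exact: cvg_id|exact: Ec].
  move=> _ [x _ <-] /=.
  have [_ _ Ksum] := hPQ.
  have : sumset K (orthogonal_complement K) x by rewrite Ksum.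
  move=> [m [n [Km]]]; rewrite -NE => Nn ->.
  have [Pn Qn] := NPQ n Nn.
  have Lm : L (Q (P m)).
    move: m Km; apply: (preimage_closure_subset (Q \o P)) => //.
    move=> _ [w _ <-] /=; apply: subset_closure; exists w => //.
    (* Regroup [D w] as [(w - P w) + (w - Q w)]; [P] kills the first term. *)
    rewrite scaler_nat mulr2n -addrA addrACA (adjointD _ _ PP (w - P w)).
    by rewrite (adjointB _ _ PP w (P w)) PK subrr add0r.
  (* Here [Q (P (m + n)) = Q (P m) + n], and [E] kills [Q (P m)], which lies in [L] and so is
     orthogonal to [N]. Subtracting the [E] part therefore leaves [Q (P m)]. *)
  rewrite (adjointD _ _ PP) (adjointD _ _ QQ) Pn Qn (adjointD _ _ EE) (EidN _ Nn).
  have QPmN : orthogonal_complement N (Q (P m)).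
    by move=> y Ny; apply: hip_eq0C; exact: NL.
  by rewrite (E0 _ QPmN) add0r addrK.
(* Translation by [n] is continuous, so it suffices to treat [m = Q (P (x - Q x))]; since
   [Q (P n) = n], the sum is the image of [x - Q x + n]. *)
- move: m Lm; apply: (preimage_closure_subset (fun m => m + n)).
  + by move=> m; apply: cvgD; [exact: cvg_id|exact: cvg_cst].
  + exact: closed_closure.
  + move=> _ [x _ <-]; apply: subset_closure; have [Pn Qn] := NPQ n Nn.
    exists (x - Q x + n) => //=.
    by rewrite (adjointD _ _ PP) (adjointD _ _ QQ) Pn Qn.
Qed.
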